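(* Let $L$ be a set of $s$ nonnegative integers and suppose that $(\mathcal{A}, \mathcal{B})$ is a pair of $L$-cross-intersecting set systems in $\mathcal{P}([n]) \times \mathcal{P}([n])$. Then $$d(\mathcal{A}, \mathcal{B}) \le \sum_{k=0}^{s-1} \binom{n}{k} 2^{n-k},$$ with equality if and only if $L = \{0, \ldots, s-1\}$.
   Context: $n$ is a positive integer, $[n] = \{1, \ldots, n\}$ and $\mathcal{P}([n])$ is its power set. A pair $(\mathcal{A}, \mathcal{B})$ of set systems $\mathcal{A}, \mathcal{B} \subset \mathcal{P}([n])$ is $L$-cross-intersecting if $|A \cap B| \in L$ whenever $A \in \mathcal{A}$ and $B \in \mathcal{B}$. $d(\mathcal{A}, \mathcal{B})$ is the number of pairs $(A,B) \in \mathcal{A} \times \mathcal{B}$ with $A \cap B = \varnothing$.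
   Formalization: Equality is read as: if L = {0,…,s−1}, some L-cross-intersecting pair attains the bound (not every pair does, e.g. empty systems); conversely, any pair attaining it forces L = {0,…,s−1}, assuming s ≤ n+1 (false without it when L contains {0,…,n}). *)

(* Defs.v *)
From mathcomp Require Import all_boot finmap.

Set Implicit Arguments.
Unset Strict Implicit.
Unset Printing Implicit Defensive.

(* The ground set [n] = {1, ..., n} is represented by the n-element type 'I_n,
   so a set system on [n] is a term of type {set {set 'I_n}}. *)

Definition cross_intersecting (n : nat) (L : {fset nat})
    (A B : {set {set 'I_n}}) : Prop :=
  forall a b : {set 'I_n}, a \in A -> b \in B -> #|a :&: b| \in L.

Definition disjoint_pairs (n : nat) (A B : {set {set 'I_n}}) : nat :=
  #|[set p : {set 'I_n} * {set 'I_n} |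
      [&& p.1 \in A, p.2 \in B & p.1 :&: p.2 == set0]]|.

(* Main.v *)
Require Import Defs.
From mathcomp Require Import all_boot finmap.

(** Only the sizes missing from L matter.  If t is not in L then the pair
(A, B) avoids cross-intersections of size t, and such a pair has at most
disjoint_bound n t = \sum_(k < t) 'C(n, k) * 2 ^ (n - k) disjoint pairs
([avoiding_disjoint_bound]).  A set L of s integers misses some t <= s, which
gives the upper bound; if L is not {0, ..., s-1} it even misses some t < s, and
then the bound for t is strictly smaller than the bound for s because s <= n.+1.
The value is attained by all subsets against the subsets with fewer than s
elements.

The bound for t-avoiding pairs is proved by induction on the ground set.  Fix a
point x, and split each family into the members without x (A0, B0) and the
members with x, from which x is deleted (A1, B1).  Then
  d(A, B) = d(A0, B0) + d(A1, B0) + d(A0, B1),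
and this is at most
  d(A0 U A1, B0) + d(A0, B0 U B1) + d(A0 /\ A1, B0 /\ B1),
a pointwise inequality between indicator functions.  The first two pairs are
still t-avoiding, while the third is (t-1)-avoiding since x can be put back on
both sides.  This matches the recurrence
  disjoint_bound n.+1 t.+1 = 2 * disjoint_bound n t.+1 + disjoint_bound n t. *)

Set Implicit Arguments.
Unset Strict Implicit.
Unset Printing Implicit Defensive.

Local Open Scope fset_scope.
Local Open Scope nat_scope.

Definition disjoint_bound (n t : nat) : nat :=
  \sum_(0 <= k < t) 'C(n, k) * 2 ^ (n - k).

(** disjoint_bound n t counts the words of length n over three letters in which
a distinguished letter occurs fewer than t times; the recurrence splits on the
first letter. *)
Lemma disjoint_boundS n t :
  disjoint_bound n.+1 t.+1 = (disjoint_bound n t.+1).*2 + disjoint_bound n t.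
Proof.
rewrite /disjoint_bound !big_nat_recl // !bin0 !subn0 !mul1n expnS.
rewrite doubleD -addnA -!mul2n; congr (_ + _).
rewrite big_distrr -big_split /=; apply: eq_bigr => k _.
rewrite binS subSS mulnDl; congr (_ + _).
(* For k >= n the truncated exponents do not match, but 'C(n, k.+1) vanishes. *)
case: (ltnP k n) => [lt_kn | le_nk]; last by rewrite bin_small ?muln0.
by rewrite mulnCA -expnS -subSn.
Qed.

Lemma disjoint_bound_gt0 n t : 0 < t -> 0 < disjoint_bound n t.
Proof.
case: t => // t _; rewrite /disjoint_bound big_nat_recl //.
by rewrite bin0 mul1n addn_gt0 expn_gt0.
Qed.

Lemma leq_disjoint_bound n t s :
  t <= s -> disjoint_bound n t <= disjoint_bound n s.
Proof.
by move=> le_ts; rewrite [leqRHS](@big_cat_nat _ _ _ t) //= leq_addr.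
Qed.

Lemma ltn_disjoint_bound n t s :
  t < s -> t <= n -> disjoint_bound n t < disjoint_bound n s.
Proof.
move=> lt_ts le_tn; apply: leq_trans (leq_disjoint_bound n lt_ts).
rewrite /disjoint_bound big_nat_recr //= -addn1 leq_add2l.
by rewrite muln_gt0 bin_gt0 le_tn expn_gt0.
Qed.

Section DisjointPairsOn.

Variable T : finType.
Implicit Types (S a b : {set T}) (A B : {set {set T}}) (x : T).

(** The families are not required to consist of subsets of S: the restriction
is put in the count, so that the same A and B serve for every S. *)
Definition disjoint_pairs_on S A B : nat :=
  \sum_(a : {set T} | a \subset S) \sum_(b : {set T} | b \subset S)
    (a :&: b == set0) * ((a \in A) * (b \in B)).

Definition avoiding_on S (t : nat) A B : Prop :=
  forall a b, a \subset S -> b \subset S -> a \in A -> b \in B ->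
    #|a :&: b| != t.

(** Only its restriction to sets without x is the usual link of A at x. *)
Definition link x A : {set {set T}} := [set a : {set T} | x |: a \in A].

Lemma sum_subsetsD1 S x (F : {set T} -> nat) : x \in S ->
  \sum_(a : {set T} | a \subset S) F a =
  \sum_(a : {set T} | a \subset S :\ x) (F a + F (x |: a)).
Proof.
move=> xS; rewrite big_split (bigID (fun a : {set T} => x \in a)) /= addnC.
congr (_ + _); first by apply: eq_bigl => a; rewrite subsetD1.
rewrite (reindex_onto (fun a => x |: a) (fun a => a :\ x)) /=; last first.
  by move=> a /andP[_ xa]; rewrite setD1K.
apply: eq_bigl => a; rewrite setU11 andbT subUset sub1set xS /= subsetD1.
case: (boolP (x \in a)) => [xa | xa] /=; last by rewrite setU1K ?eqxx.
rewrite andbF; apply/negbTE/nandP; right.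
by apply: contraTneq xa => <-; rewrite !inE eqxx.
Qed.

Lemma disjoint_pairs_onD1 S x A B : x \in S ->
  disjoint_pairs_on S A B =
  disjoint_pairs_on (S :\ x) A B + disjoint_pairs_on (S :\ x) (link x A) B
  + disjoint_pairs_on (S :\ x) A (link x B).
Proof.
move=> xS; rewrite /disjoint_pairs_on (sum_subsetsD1 _ xS) -!big_split /=.
apply: eq_bigr => a; rewrite subsetD1 => /andP[_ xa].
rewrite !(sum_subsetsD1 _ xS) -!big_split /=.
apply: eq_bigr => b; rewrite subsetD1 => /andP[_ xb].
have meet_l : (x |: a) :&: b = a :&: b.
  by apply/setP => y; rewrite !inE; case: eqP => // ->; rewrite (negbTE xb) !andbF.
have meet_r : a :&: (x |: b) = a :&: b.
  by apply/setP => y; rewrite !inE; case: eqP => // ->; rewrite (negbTE xa).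
have meet_lr : ((x |: a) :&: (x |: b) == set0) = false.
  by apply/negbTE/set0Pn; exists x; rewrite !inE eqxx.
by rewrite meet_l meet_r meet_lr !inE mul0n addn0 addnAC.
Qed.

(** Termwise, with indicators a0, a1, b0, b1: if a0 = 0 or b0 = 0 the left side
has a single term, present on the right; if a0 = b0 = 1 the claim reads
1 + a1 + b1 <= 2 + a1 b1, that is 0 <= (1 - a1)(1 - b1). *)
Lemma leq_disjoint_pairs_onUI S (A0 A1 B0 B1 : {set {set T}}) :
  disjoint_pairs_on S A0 B0 + disjoint_pairs_on S A1 B0
    + disjoint_pairs_on S A0 B1
  <= disjoint_pairs_on S (A0 :|: A1) B0 + disjoint_pairs_on S A0 (B0 :|: B1)
    + disjoint_pairs_on S (A0 :&: A1) (B0 :&: B1).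
Proof.
rewrite /disjoint_pairs_on -!big_split; apply: leq_sum => a _ /=.
rewrite -!big_split; apply: leq_sum => b _ /=.
rewrite -!mulnDr leq_mul2l !inE; apply/orP; right.
by case: (a \in A0); case: (a \in A1); case: (b \in B0); case: (b \in B1).
Qed.

Lemma disjoint_pairs_on_avoiding0 S A B :
  avoiding_on S 0 A B -> disjoint_pairs_on S A B = 0.
Proof.
move=> av; rewrite /disjoint_pairs_on big1 // => a aS.
rewrite big1 // => b bS; case: eqP => // ab0.
case aA: (a \in A); case bB: (b \in B) => //.
by have := av a b aS bS aA bB; rewrite ab0 cards0.
Qed.

(** Restoring x on one side leaves a :&: b unchanged, because the other side
does not contain x; restoring it on both sides adds exactly one element. *)
Lemma avoiding_onD1 S x t A B : x \in S ->
  avoiding_on S t.+1 A B ->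
  [/\ avoiding_on (S :\ x) t.+1 (A :|: link x A) B,
      avoiding_on (S :\ x) t.+1 A (B :|: link x B)
    & avoiding_on (S :\ x) t (A :&: link x A) (B :&: link x B)].
Proof.
move=> xS av.
have add a : a \subset S -> x |: a \subset S by rewrite subUset sub1set xS.
split=> a b; rewrite !subsetD1 !inE => /andP[aS xa] /andP[bS xb].
- case/orP=> aA bB; first exact: av.
  have <- : (x |: a) :&: b = a :&: b; last by apply: av => //; apply: add.
  by apply/setP => y; rewrite !inE; case: eqP => // ->; rewrite (negbTE xb) !andbF.
- move=> aA /orP[] bB; first exact: av.
  have <- : a :&: (x |: b) = a :&: b; last by apply: av => //; apply: add.
  by apply/setP => y; rewrite !inE; case: eqP => // ->; rewrite (negbTE xa).
- move=> /andP[_ aA] /andP[_ bB].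
  have := av _ _ (add a aS) (add b bS) aA bB.
  by rewrite -setUIr cardsU1 inE (negbTE xa).
Qed.

(** Induction on the ground set: deleting a point x costs one unit of t only
for the sets that belong to their family both with and without x, and these are
the pairs counted by the last term of the recurrence. *)
Theorem avoiding_on_disjoint_bound S t A B :
  avoiding_on S t A B -> disjoint_pairs_on S A B <= disjoint_bound #|S| t.
Proof.
have [m] := ubnP #|S|; elim: m S t A B => // m IH S [|t] A B ltSm av.
  by rewrite disjoint_pairs_on_avoiding0.
have [S0 | [x xS]] := set_0Vmem S.
  apply: leq_trans (disjoint_bound_gt0 _ (ltn0Sn t)).
  rewrite /disjoint_pairs_on S0 (eq_bigl (pred1 set0)); last first.
    by move=> a; rewrite subset0.
  rewrite big_pred1_eq (eq_bigl (pred1 set0)); last first.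
    by move=> a; rewrite subset0.
  by rewrite big_pred1_eq; case: eqP; case: (_ \in A); case: (_ \in B).
have [av1 av2 av3] := avoiding_onD1 xS av.
have cardS : #|S| = #|S :\ x|.+1 by rewrite (cardsD1 x) xS.
rewrite (disjoint_pairs_onD1 _ _ xS) cardS disjoint_boundS -addnn.
apply: leq_trans (leq_disjoint_pairs_onUI _ _ _ _ _) _.
by apply: leq_add; [apply: leq_add|]; apply: IH; rewrite // -ltnS -cardS.
Qed.

End DisjointPairsOn.

Lemma disjoint_pairsE n (A B : {set {set 'I_n}}) :
  disjoint_pairs A B = disjoint_pairs_on setT A B.
Proof.
rewrite /disjoint_pairs /disjoint_pairs_on -sum1dep_card big_mkcond /=.
under [RHS]eq_bigl => a do rewrite subsetT.
under [RHS]eq_bigr => a _ do under eq_bigl => b do rewrite subsetT.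
rewrite pair_bigA /=; apply: eq_bigr => -[a b] _ /=.
by case: (a \in A); case: (b \in B); case: eqP.
Qed.

Theorem avoiding_disjoint_bound n t (A B : {set {set 'I_n}}) :
  (forall a b, a \in A -> b \in B -> #|a :&: b| != t) ->
  disjoint_pairs A B <= disjoint_bound n t.
Proof.
move=> av; rewrite disjoint_pairsE -[n in leqRHS]card_ord -cardsT.
by apply: avoiding_on_disjoint_bound => a b _ _; apply: av.
Qed.

(** The extremal pair: a set b of size k is disjoint from the 2 ^ (n - k)
subsets of its complement. *)
Lemma disjoint_pairs_small_sets n s :
  disjoint_pairs [set: {set 'I_n}] [set b : {set 'I_n} | #|b| < s]
  = disjoint_bound n s.
Proof.
rewrite disjoint_pairsE /disjoint_pairs_on exchange_big /=.
transitivity (\sum_(b : {set 'I_n} | #|b| < s) 2 ^ (n - #|b|)).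
  rewrite [RHS]big_mkcond; apply: eq_big => [b | b _]; first by rewrite subsetT.
  rewrite inE; case: ifP => lt_bs; last first.
    by rewrite big1 // => a _; rewrite !muln0.
  have -> : n - #|b| = #|~: b| by rewrite [RHS]cardsCs setCK card_ord.
  rewrite -card_powerset -sum1_card [RHS]big_mkcond.
  apply: eq_big => [a | a _]; first by rewrite subsetT.
  by rewrite !inE !muln1 setI_eq0 -disjoints_subset; case: ifP.
rewrite /disjoint_bound big_mkord.
transitivity (\sum_(b : {set 'I_n} | #|b| < s)
                \sum_(k < s | #|b| == k) 2 ^ (n - k)).
  apply: eq_bigr => b lt_bs; by rewrite (big_pred1 (Ordinal lt_bs)).
rewrite (exchange_big_dep xpredT) //=; apply: eq_bigr => k _.
rewrite sum_nat_cond_const; congr (_ * _).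
rewrite -[n in 'C(n, _)]card_ord -card_draws; apply: eq_card => b.
by rewrite !inE; case: eqP => [->|]; rewrite ?ltn_ord ?andbF.
Qed.

Lemma card_fset_iota s : #|` [fset k in iota 0 s]| = s.
Proof. by rewrite card_fseq undup_id ?iota_uniq ?size_iota. Qed.

Lemma in_fset_iota s k : (k \in [fset i in iota 0 s]) = (k < s).
Proof. by rewrite in_fset mem_iota. Qed.

(** Comparing cardinals, m = #|` L|.+1 rules out the inclusion, while for
m = #|` L| the inclusion is an equality. *)
Lemma fset_iota_sub_or_missing (L : {fset nat}) m :
  [fset k in iota 0 m] `<=` L \/ exists2 t, t < m & t \notin L.
Proof.
have [sub | /fsubsetPn[t]] := boolP ([fset k in iota 0 m] `<=` L); first by left.
by rewrite in_fset_iota; right; exists t.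
Qed.

Lemma missing_leq_card (L : {fset nat}) :
  exists2 t, t <= #|` L| & t \notin L.
Proof.
have [/fsubset_leq_card|//] := fset_iota_sub_or_missing L #|` L|.+1.
by rewrite card_fset_iota ltnn.
Qed.

Lemma missing_ltn_card (L : {fset nat}) :
  L != [fset k in iota 0 #|` L|] -> exists2 t, t < #|` L| & t \notin L.
Proof.
have [sub /negP[]|//] := fset_iota_sub_or_missing L #|` L|.
by rewrite eq_sym eqEfcard card_fset_iota leqnn andbT.
Qed.

Lemma cross_intersecting_bound n (L : {fset nat}) (A B : {set {set 'I_n}}) t :
  t \notin L -> cross_intersecting L A B ->
  disjoint_pairs A B <= disjoint_bound n t.
Proof.
move=> tL crossAB; apply: avoiding_disjoint_bound => a b aA bB.
by apply: contraNneq tL => <-; apply: crossAB.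
Qed.

Theorem corollary1p3 (n : nat) (n_gt0 : 0 < n) (s : nat) (L : {fset nat})
    (card_L : #|` L| = s) :
  [/\ (* the upper bound *)
      forall A B : {set {set 'I_n}}, cross_intersecting L A B ->
        disjoint_pairs A B <= \sum_(0 <= k < s) 'C(n, k) * 2 ^ (n - k),
      (* equality can occur only for L = {0, ..., s-1} *)
      s <= n.+1 ->
      forall A B : {set {set 'I_n}}, cross_intersecting L A B ->
        disjoint_pairs A B = \sum_(0 <= k < s) 'C(n, k) * 2 ^ (n - k) ->
        L = [fset k in iota 0 s]
    & (* equality does occur for L = {0, ..., s-1} *)
      L = [fset k in iota 0 s] ->
      exists A B : {set {set 'I_n}}, cross_intersecting L A B /\
        disjoint_pairs A B = \sum_(0 <= k < s) 'C(n, k) * 2 ^ (n - k)].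
Proof.
rewrite -/(disjoint_bound n s) -card_L; split.
- move=> A B crossAB; have [t le_t tL] := missing_leq_card L.
  exact: leq_trans (cross_intersecting_bound tL crossAB) (leq_disjoint_bound n le_t).
- move=> le_n A B crossAB dAB; apply/eqP/contraT => neqL.
  have [t lt_t tL] := missing_ltn_card neqL.
  have := cross_intersecting_bound tL crossAB.
  by rewrite dAB leqNgt ltn_disjoint_bound // -ltnS (leq_trans lt_t).
- move=> eqL; exists setT, [set b : {set 'I_n} | #|b| < #|` L|].
  split; last exact: disjoint_pairs_small_sets.
  move=> a b _; rewrite inE => lt_b; rewrite eqL in_fset_iota.
  exact: leq_ltn_trans (subset_leq_card (subsetIr a b)) lt_b.
Qed.
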